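(* Let $I\subset(0,\infty)$ be an open interval, let $f:I\to\mathbb{R}$ be of class $C^2$, let $r_0\in I$, and let $\Sigma=\{(x,y,t)\in\mathbb{H}: r=\sqrt{x^2+y^2}\in I,\ t=f(r)\}$ be the corresponding surface of revolution in the Heisenberg group. Then: (1) $\Sigma$ has horizontal Gauss curvature $K^h_\Sigma\equiv 0$ if and only if there are constants $C,C'\in\mathbb{R}$, $C\ne0$, such that $Cr^2-4>0$ on $I$ and $t=f(r)$ satisfies $$(t-C')^2=\frac{1}{9C^2}(Cr^2-4)^3\qquad (r\in I).$$ (2) $\Sigma$ has $K^h_\Sigma\equiv k$ with $k=1$ (upper signs inside the root and in the conditions), respectively $k=-1$ (lower signs inside the root and in the conditions), if and only if there are constants $C,C'\in\mathbb{R}$ such that $C\mp r^4>0$ and $\pm r^4+4r^2-C>0$ for all $r\in I$, and, for one choice of $\varepsilon\in\{1,-1\}$, $$f(r)=C'+\varepsilon\int_{r_0}^r 2s\sqrt{\frac{\pm s^4+4s^2-C}{C\mp s^4}}\,ds\qquad (r\in I).$$ In the special case $C=0$ (which occurs only for $k=-1$) this is the one parameter family of surfaces $$t-C'=\varepsilon\left(r\sqrt{4-r^2}+4\arctan\left(\frac{r}{\sqrt{4-r^2}}\right)\right),\qquad \varepsilon\in\{1,-1\},\ C'\in\mathbb{R}.$$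
   Context: The Heisenberg group $\mathbb{H}$ is $\mathbb{R}^3$ with coordinates $(x,y,t)$ and group law $(x,y,t)\cdot(x',y',t')=(x+x',y+y',t+t'+2(yx'-xy'))$. Its left-invariant frame is $X=\partial_x+2y\,\partial_t$, $Y=\partial_y-2x\,\partial_t$, $T=\partial_t$, with $[X,Y]=-4T$; the horizontal distribution is spanned by the orthonormal fields $X,Y$. For a surface $\Sigma=\{u=0\}$ with $C^2$ defining function $u$, put $\|\nabla_Hu\|=\sqrt{(Xu)^2+(Yu)^2}$. At non-characteristic points (those where $\|\nabla_Hu\|\neq0$) put $\overline p=Xu/\|\nabla_Hu\|$, $\overline q=Yu/\|\nabla_Hu\|$, $E_1=-\overline q X+\overline p Y$. The horizontal Gauss curvature is $$K^h_\Sigma=-4E_1\left(\frac{Tu}{\|\nabla_Hu\|}\right)-16\left(\frac{Tu}{\|\nabla_Hu\|}\right)^2 .$$ For the surface of revolution $t=f(r)$, $r=\sqrt{x^2+y^2}$, the defining function is $u=t-f(r)$; there are no characteristic points with $r>0$. *)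

(* Defs.v *)
(* Stdlib real numbers and Coquelicot.  [Derive] and [RInt] are total; below they
   are only evaluated where the derivative or integral exists. *)
From Stdlib Require Import Reals.
From Coquelicot Require Import Coquelicot.
Open Scope R_scope.

Record heis : Type := Heis { hx : R; hy : R; ht : R }.

Definition hmul (P Q : heis) : heis :=
  Heis (hx P + hx Q) (hy P + hy Q)
       (ht P + ht Q + 2 * (hy P * hx Q - hx P * hy Q)).

Definition d_x (u : heis -> R) (P : heis) : R :=
  Derive (fun x => u (Heis x (hy P) (ht P))) (hx P).
Definition d_y (u : heis -> R) (P : heis) : R :=
  Derive (fun y => u (Heis (hx P) y (ht P))) (hy P).
Definition d_t (u : heis -> R) (P : heis) : R :=
  Derive (fun t => u (Heis (hx P) (hy P) t)) (ht P).

Definition X (u : heis -> R) (P : heis) : R := d_x u P + 2 * hy P * d_t u P.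
Definition Y (u : heis -> R) (P : heis) : R := d_y u P - 2 * hx P * d_t u P.
Definition T (u : heis -> R) (P : heis) : R := d_t u P.

(* The coefficients of X and Y at P are the velocities at s = 0 of the
   left-translated axes s |-> P.(s,0,0) and s |-> P.(0,s,0), so the frame is
   left invariant for [hmul]. *)
Lemma X_left_translate (P : heis) :
  is_derive (fun s => hx (hmul P (Heis s 0 0))) 0 1 /\
  is_derive (fun s => hy (hmul P (Heis s 0 0))) 0 0 /\
  is_derive (fun s => ht (hmul P (Heis s 0 0))) 0 (2 * hy P).
Proof. split; [|split]; simpl; auto_derive; auto; ring. Qed.

Lemma Y_left_translate (P : heis) :
  is_derive (fun s => hx (hmul P (Heis 0 s 0))) 0 0 /\
  is_derive (fun s => hy (hmul P (Heis 0 s 0))) 0 1 /\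
  is_derive (fun s => ht (hmul P (Heis 0 s 0))) 0 (- 2 * hx P).
Proof. split; [|split]; simpl; auto_derive; auto; ring. Qed.

Definition normH (u : heis -> R) (P : heis) : R := sqrt (X u P ^ 2 + Y u P ^ 2).

Definition characteristic (u : heis -> R) (P : heis) : Prop := normH u P = 0.

Definition pbar (u : heis -> R) (P : heis) : R := X u P / normH u P.
Definition qbar (u : heis -> R) (P : heis) : R := Y u P / normH u P.

Definition E1 (u g : heis -> R) (P : heis) : R :=
  - qbar u P * X g P + pbar u P * Y g P.

(* Meaningful at non-characteristic points only. *)
Definition horizontal_gauss_curvature (u : heis -> R) (P : heis) : R :=
  - 4 * E1 u (fun Q => T u Q / normH u Q) P - 16 * (T u P / normH u P) ^ 2.

Definition constant_curvature (Sigma : heis -> Prop) (u : heis -> R) (k : R) : Prop :=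
  forall P, Sigma P -> ~ characteristic u P -> horizontal_gauss_curvature u P = k.

Definition radius (P : heis) : R := sqrt (hx P ^ 2 + hy P ^ 2).

Definition revolution (I : R -> Prop) (f : R -> R) (P : heis) : Prop :=
  I (radius P) /\ ht P = f (radius P).

Definition revolution_fun (f : R -> R) (P : heis) : R := ht P - f (radius P).

Definition is_open_interval (I : R -> Prop) : Prop :=
  exists a b : Rbar, forall x : R, I x <-> Rbar_lt a x /\ Rbar_lt x b.

(* A function on the open set I is represented by a total function whose values
   outside I are irrelevant.  All orders k <= n are listed because
   [ex_derive_n f n x] only asserts differentiability of [Derive_n f (n - 1)] at x. *)
Definition class_C (n : nat) (I : R -> Prop) (f : R -> R) : Prop :=
  (forall (k : nat) (x : R), (k <= n)%nat -> I x -> ex_derive_n f k x) /\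
  (forall x : R, I x -> continuous (Derive_n f n) x).

(* Upper signs are k = 1, lower signs k = -1. *)
Definition admissible (k C : R) (I : R -> Prop) : Prop :=
  forall r, I r -> 0 < C - k * r ^ 4 /\ 0 < k * r ^ 4 + 4 * r ^ 2 - C.

Definition profile (k C r0 C' eps r : R) : R :=
  C' + eps * RInt (fun s => 2 * s * sqrt ((k * s ^ 4 + 4 * s ^ 2 - C) / (C - k * s ^ 4))) r0 r.

(* Main.v *)
Require Import Defs.
From Stdlib Require Import Reals Ranalysis5 Lra.
From Coquelicot Require Import Coquelicot.
Open Scope R_scope.

(** A surface of revolution has only one curvature function of one variable, and
    the equation that this curvature is constant has a first integral.

    Put W(r) = f'(r)^2 + 4 r^2.  Away from the axis the horizontal gradient of
    u = t - f(r) has squared norm W, which never vanishes, and T u = 1, so the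
    function differentiated by E1 in the curvature is W^(-1/2), a function of r
    alone.  The chain rule then gives ([revolution_curvature])
<<
      K = 4 (r W' - 4 W) / W^2 .
>>
    Since (16 r^4 / W)' = 16 r^3 (4 W - r W') / W^2 = - 4 r^3 K, the curvature
    is the constant k exactly when 16 r^4 / W + k r^4 is a constant C
    ([first_integral]).  Solving for f' gives
<<
      f'^2 = 4 r^2 (k r^4 + 4 r^2 - C) / (C - k r^4) .
>>
    The denominator is positive because W is.  The numerator h is nonnegative
    as f'^2 is; it cannot vanish, for a zero would be an interior minimum of h,
    and at a critical point of h inside I the polynomial h has a strict maximum
    ([first_integral_admissible]).  Hence the continuous function f' has no zero
    and a constant sign eps, so that f' is eps times the positive root
    ([constant_curvature_slope]).

    What remains is integration.  For every k it gives the integral formula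
    ([eq_profile_iff_derive]); for k = 0 and for k = -1, C = 0 the primitive is
    elementary ([flat_primitive], [arctan_primitive]). *)

(** * Calculus on an open interval *)

Lemma open_interval_locally (I : R -> Prop) (r : R) :
  is_open_interval I -> I r -> locally r I.
Proof.
intros [a [b HI]] Ir; apply HI in Ir as [Ha Hb].
apply filter_imp with (fun x : R => Rbar_lt a x /\ Rbar_lt x b).
  now intros x Hx; apply HI.
now apply filter_and; [apply open_Rbar_gt | apply open_Rbar_lt].
Qed.

Lemma open_interval_convex (I : R -> Prop) (a b c : R) :
  is_open_interval I -> I a -> I b -> a <= c <= b -> I c.
Proof.
intros [u [v HI]] Ia Ib Hc; apply HI in Ia; apply HI in Ib; apply HI; split.
  now apply Rbar_lt_le_trans with a; simpl; tauto.
now apply Rbar_le_lt_trans with b; simpl; tauto.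
Qed.

Lemma open_interval_minmax (I : R -> Prop) (a b c : R) :
  is_open_interval I -> I a -> I b -> Rmin a b <= c <= Rmax a b -> I c.
Proof.
intros HI Ia Ib; unfold Rmin, Rmax.
destruct (Rle_dec a b); intros Hc.
  now apply open_interval_convex with a b.
now apply open_interval_convex with b a.
Qed.

(** Every integration below goes through this form of uniqueness of primitives,
    normalised at the base point r0. *)
Lemma eq_derive_diff_const (I : R -> Prop) (F G dF : R -> R) (r0 r : R) :
  is_open_interval I -> I r0 ->
  (forall x, I x -> is_derive F x (dF x)) ->
  (forall x, I x -> is_derive G x (dF x)) ->
  I r -> F r - G r = F r0 - G r0.
Proof.
intros HI I0 HF HG Ir.
assert (D : forall x, I x -> is_derive (fun y => F y - G y) x 0).
  intros x Ix.
  replace 0 with (minus (dF x) (dF x)) by (unfold minus, plus, opp; simpl; ring).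
  now apply @is_derive_minus; auto.
destruct (MVT_gen (fun y => F y - G y) r0 r (fun _ => 0)) as [c [_ Hc]].
- intros x Hx; apply D; apply open_interval_minmax with r0 r; auto; lra.
- intros x Hx; apply continuity_pt_filterlim.
  apply (ex_derive_continuous (fun y => F y - G y)); exists 0; apply D.
  now apply open_interval_minmax with r0 r.
- lra.
Qed.

Lemma locally_eq_is_derive (I : R -> Prop) (F G : R -> R) (r l : R) :
  is_open_interval I -> I r -> (forall x, I x -> F x = G x) ->
  is_derive G r l -> is_derive F r l.
Proof.
intros HI Ir E; apply is_derive_ext_loc.
apply filter_imp with I; [|now apply open_interval_locally].
now intros x Ix; rewrite E.
Qed.

(** This turns knowledge of f'^2 into knowledge of f' up to one global sign. *)
Lemma nonvanishing_constant_sign (I : R -> Prop) (g : R -> R) (r0 : R) :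
  is_open_interval I -> I r0 ->
  (forall x, I x -> continuous g x) -> (forall x, I x -> g x <> 0) ->
  exists eps, (eps = 1 \/ eps = -1) /\ forall r, I r -> 0 < eps * g r.
Proof.
intros HI I0 Cg Ng.
assert (K : forall h a b, (forall x, I x -> continuous h x) ->
    (forall x, I x -> h x <> 0) -> I a -> I b -> a < b -> h a < 0 -> 0 < h b -> False).
  intros h a b Ch Nh Ia Ib ab ha hb.
  destruct (IVT_interv h a b) as [z [Hz Ez]]; auto.
    intros x Hx; apply continuity_pt_filterlim, Ch.
    now apply open_interval_convex with a b.
  now apply (Nh z); [apply open_interval_convex with a b|].
assert (Co : forall x, I x -> continuous (fun y => - g y) x).
  now intros x Ix; apply @continuous_opp; apply Cg.
assert (No : forall x, I x -> - g x <> 0) by (intros x Ix; specialize (Ng x Ix); lra).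
assert (P : forall a b, I a -> I b -> g a < 0 -> 0 < g b -> False).
  intros a b Ia Ib ha hb; destruct (Rtotal_order a b) as [h|[h|h]].
  - now apply (K g a b).
  - subst b; lra.
  - apply (K (fun y => - g y) b a); auto; lra.
destruct (Rlt_dec 0 (g r0)) as [h|h].
  exists 1; split; [now left|]; intros r Ir.
  destruct (Rtotal_order (g r) 0) as [h'|[h'|h']]; [|now destruct (Ng r)|lra].
  now destruct (P r r0).
exists (-1); split; [now right|]; intros r Ir.
assert (g r0 < 0) by (specialize (Ng r0 I0); lra).
destruct (Rtotal_order (g r) 0) as [h'|[h'|h']]; [lra|now destruct (Ng r)|].
now destruct (P r0 r).
Qed.

(** * The horizontal frame on functions of t and r *)

(** Both functions whose horizontal derivatives enter the curvature have the
    form c t + phi(r): the defining function t - f(r) with c = 1, and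
    Tu / ||grad_H u|| with c = 0.  The equality is required only where the
    radius lies in I because the second one is radial only there; as I is open
    this determines the derivatives. *)
Lemma radial_frame (I : R -> Prop) (g : heis -> R) (c l : R) (phi : R -> R) (P : heis) :
  is_open_interval I -> I (radius P) -> 0 < radius P ->
  (forall Q, I (radius Q) -> g Q = c * ht Q + phi (radius Q)) ->
  is_derive phi (radius P) l ->
  X g P = l * (hx P / radius P) + 2 * hy P * c /\
  Y g P = l * (hy P / radius P) - 2 * hx P * c /\
  T g P = c.
Proof.
intros HI; destruct P as [x y t]; intros IP rP Hg Hphi.
assert (Hpos : 0 < x ^ 2 + y ^ 2).
  destruct (Rle_lt_or_eq_dec 0 (x ^ 2 + y ^ 2)) as [h|h]; [nra|exact h|].
  now unfold radius in rP; simpl hx in rP; simpl hy in rP; rewrite <- h, sqrt_0 in rP; lra.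
assert (Dx : is_derive (fun z => radius (Heis z y t)) x (x / radius (Heis x y t))).
  unfold radius in *; simpl in *; auto_derive; [lra|]; simpl; field; lra.
assert (Dy : is_derive (fun z => radius (Heis x z t)) y (y / radius (Heis x y t))).
  unfold radius in *; simpl in *; auto_derive; [lra|]; simpl; field; lra.
assert (Ex : d_x g (Heis x y t) = l * (x / radius (Heis x y t))).
  unfold d_x; simpl hx; simpl hy; simpl ht; apply is_derive_unique.
  apply is_derive_ext_loc with (fun z => c * t + phi (radius (Heis z y t))).
    apply filter_imp with (fun z => I (radius (Heis z y t))).
      now intros z Iz; rewrite (Hg _ Iz).
    apply (ex_derive_continuous (fun z => radius (Heis z y t))); [now eexists; exact Dx|].
    now apply open_interval_locally.
  replace (l * _) with (plus 0 (scal (x / radius (Heis x y t)) l)) by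
    (unfold plus, scal; simpl; unfold mult; simpl; ring).
  apply @is_derive_plus; [apply @is_derive_const|].
  now apply @is_derive_comp.
assert (Ey : d_y g (Heis x y t) = l * (y / radius (Heis x y t))).
  unfold d_y; simpl hx; simpl hy; simpl ht; apply is_derive_unique.
  apply is_derive_ext_loc with (fun z => c * t + phi (radius (Heis x z t))).
    apply filter_imp with (fun z => I (radius (Heis x z t))).
      now intros z Iz; rewrite (Hg _ Iz).
    apply (ex_derive_continuous (fun z => radius (Heis x z t))); [now eexists; exact Dy|].
    now apply open_interval_locally.
  replace (l * _) with (plus 0 (scal (y / radius (Heis x y t)) l)) by
    (unfold plus, scal; simpl; unfold mult; simpl; ring).
  apply @is_derive_plus; [apply @is_derive_const|].
  now apply @is_derive_comp.
assert (Et : d_t g (Heis x y t) = c).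
  unfold d_t; simpl hx; simpl hy; simpl ht; apply is_derive_unique.
  apply is_derive_ext with (fun z => c * z + phi (radius (Heis x y t))).
    now intros z; rewrite Hg.
  auto_derive; [easy|ring].
now unfold X, Y, T; rewrite Ex, Ey, Et.
Qed.

(** * The curvature of a surface of revolution *)

(** The value of (Xu)^2 + (Yu)^2 at radius r, for u = t - f(r). *)
Definition normH_sq (f : R -> R) (r : R) : R := Derive f r ^ 2 + 4 * r ^ 2.

Lemma radius_sq (P : heis) : radius P ^ 2 = hx P ^ 2 + hy P ^ 2.
Proof.
unfold radius; apply pow2_sqrt; nra.
Qed.

Lemma normH_sq_pos (f : R -> R) (r : R) : 0 < r -> 0 < normH_sq f r.
Proof. unfold normH_sq; intros; nra. Qed.

Lemma revolution_frame (I : R -> Prop) (f : R -> R) (P : heis) :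
  is_open_interval I -> (forall r, I r -> ex_derive f r) ->
  I (radius P) -> 0 < radius P ->
  let r := radius P in let u := revolution_fun f in
  X u P = - Derive f r * (hx P / r) + 2 * hy P /\
  Y u P = - Derive f r * (hy P / r) - 2 * hx P /\
  T u P = 1.
Proof.
intros HI Df IP rP r u.
destruct (radial_frame I u 1 (- Derive f r) (fun s => - f s) P) as [-> [-> ->]]; auto.
- intros Q _; unfold u, revolution_fun; ring.
- apply @is_derive_opp; apply Derive_correct; auto.
- unfold r; repeat split; ring.
Qed.

(** The radial part (-f' x/r, -f' y/r) and the rotational part (2y, -2x) of
    (Xu, Yu) are orthogonal, so their squared lengths add up. *)
Lemma normH_revolution (I : R -> Prop) (f : R -> R) (P : heis) :
  is_open_interval I -> (forall r, I r -> ex_derive f r) ->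
  I (radius P) -> 0 < radius P ->
  normH (revolution_fun f) P = sqrt (normH_sq f (radius P)).
Proof.
intros HI Df IP rP; unfold normH, normH_sq; f_equal.
destruct (revolution_frame I f P) as [-> [-> _]]; auto.
assert (E := radius_sq P); set (r := radius P) in *.
transitivity ((Derive f r ^ 2 / r ^ 2 + 4) * (hx P ^ 2 + hy P ^ 2)).
  field; lra.
rewrite <- E; field; lra.
Qed.

(** E1 is tangent to the surface, and its radial component is
    2r / ||grad_H u||: the terms of E1(r) containing f' cancel.  So
    E1 (W^(-1/2)) = (2r / W^(1/2)) (W^(-1/2))' = - r W' / W^2. *)
Lemma revolution_curvature (I : R -> Prop) (f : R -> R) (P : heis) (dW : R) :
  is_open_interval I -> (forall r, I r -> 0 < r) -> (forall r, I r -> ex_derive f r) ->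
  I (radius P) -> is_derive (normH_sq f) (radius P) dW ->
  horizontal_gauss_curvature (revolution_fun f) P =
  4 * (radius P * dW - 4 * normH_sq f (radius P)) / normH_sq f (radius P) ^ 2.
Proof.
intros HI Ipos Df IP DW.
assert (rP := Ipos _ IP); assert (WP := normH_sq_pos f _ rP).
assert (E := radius_sq P).
unfold horizontal_gauss_curvature, Defs.E1, pbar, qbar.
destruct (revolution_frame I f P) as [EX [EY ET]]; auto.
rewrite (normH_revolution I f P) by auto.
set (g := fun Q => _).
set (r := radius P) in *; set (W := normH_sq f r) in *.
assert (sW : 0 < sqrt W) by now apply sqrt_lt_R0.
assert (ssW : sqrt W * sqrt W = W) by (apply sqrt_sqrt; lra).
destruct (radial_frame I g 0 (- dW / (2 * (sqrt W * W)))
   (fun s => / sqrt (normH_sq f s)) P) as [EgX [EgY _]]; auto.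
- intros Q IQ; unfold g.
  destruct (revolution_frame I f Q) as [_ [_ ->]]; auto.
  rewrite (normH_revolution I f Q) by auto; unfold Rdiv; ring.
- fold r; replace (- dW / (2 * (sqrt W * W)))
    with (- (dW / (2 * sqrt W)) / (sqrt W) ^ 2).
    apply (is_derive_inv (fun s => sqrt (normH_sq f s))); [|unfold W in sW; lra].
    now apply (is_derive_sqrt (normH_sq f)).
  replace (sqrt W ^ 2) with W by (simpl; lra); field; lra.
rewrite EX, EY, EgX, EgY, ET; fold r; set (d := Derive f r).
replace ((1 / sqrt W) ^ 2) with (1 / (sqrt W * sqrt W)) by (field; lra).
transitivity (4 * dW / (sqrt W * sqrt W * W) * (hx P ^ 2 + hy P ^ 2) / r
    - 16 / (sqrt W * sqrt W)).
  field; lra.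
rewrite ssW, <- E; field; split; lra.
Qed.

(** The point (r, 0, f(r)) of the surface realises every radius r in I, and W > 0
    rules out characteristic points. *)
Lemma constant_curvature_ode (I : R -> Prop) (f dW : R -> R) (k : R) :
  is_open_interval I -> (forall r, I r -> 0 < r) -> (forall r, I r -> ex_derive f r) ->
  (forall r, I r -> is_derive (normH_sq f) r (dW r)) ->
  constant_curvature (revolution I f) (revolution_fun f) k <->
  forall r, I r -> 4 * (r * dW r - 4 * normH_sq f r) / normH_sq f r ^ 2 = k.
Proof.
intros HI Ipos Df DW; split.
- intros H r Ir; assert (r_gt0 := Ipos r Ir).
  assert (Er : radius (Heis r 0 (f r)) = r).
    unfold radius; simpl hx; simpl hy.
    replace (r ^ 2 + 0 ^ 2) with (r ^ 2) by ring; apply sqrt_pow2; lra.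
  rewrite <- (H (Heis r 0 (f r))).
  + rewrite (revolution_curvature I f _ (dW r)); try rewrite Er; auto.
  + now split; rewrite Er.
  + unfold characteristic; rewrite (normH_revolution I f); try rewrite Er; auto.
    apply Rgt_not_eq, sqrt_lt_R0, normH_sq_pos; auto.
- intros H P [IP _] _.
  now rewrite (revolution_curvature I f P (dW (radius P))); auto.
Qed.

(** * The first integral *)

(** The quantity Phi = 16 r^4 / W + k r^4 has derivative 4 r^3 (k - K), hence is
    constant exactly when K = k. *)
Lemma first_integral (I : R -> Prop) (f : R -> R) (r0 k : R) :
  is_open_interval I -> (forall r, I r -> 0 < r) -> I r0 -> class_C 2 I f ->
  constant_curvature (revolution I f) (revolution_fun f) k <->
  exists C, forall r, I r -> 16 * r ^ 4 = (C - k * r ^ 4) * normH_sq f r.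
Proof.
intros HI Ipos I0 [Df _].
assert (Df1 : forall r, I r -> ex_derive f r).
  intros r Ir; apply (Df 1%nat r); auto.
assert (DW : forall r, I r -> is_derive (normH_sq f) r
    (2 * Derive f r * Derive (Derive f) r + 8 * r)).
  intros r Ir; unfold normH_sq; auto_derive.
    exact (Df 2%nat r (le_n _) Ir).
  change (Derive (fun x => Derive f x) r) with (Derive (Derive f) r); ring.
rewrite (constant_curvature_ode I f _ k HI Ipos Df1 DW).
set (dW := fun r => 2 * Derive f r * Derive (Derive f) r + 8 * r) in *.
set (Phi := fun r => 16 * r ^ 4 / normH_sq f r + k * r ^ 4).
assert (DPhi : forall r, I r -> is_derive Phi r
    (4 * r ^ 3 * (k - 4 * (r * dW r - 4 * normH_sq f r) / normH_sq f r ^ 2))).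
  intros r Ir; unfold Phi.
  assert (W := normH_sq_pos f r (Ipos r Ir)).
  assert (D := DW r Ir).
  auto_derive.
    split; [eexists; exact D|]; split; [lra|easy].
  change (Derive (fun x => normH_sq f x) r) with (Derive (normH_sq f) r).
  rewrite (is_derive_unique _ _ _ D); fold (dW r); field; lra.
split.
- intros H; exists (Phi r0); intros r Ir.
  assert (W := normH_sq_pos f r (Ipos r Ir)).
  assert (E : Phi r - 0 = Phi r0 - 0).
    apply (eq_derive_diff_const I Phi (fun _ => 0) (fun _ => 0)); auto.
      intros x Ix; replace 0 with (4 * x ^ 3 * (k - k)) by ring.
      rewrite <- (H x Ix) at 2; auto.
    intros x Ix; apply @is_derive_const.
  replace (Phi r0) with (Phi r) by lra; unfold Phi; field; lra.
- intros [C H] r Ir; assert (W := normH_sq_pos f r (Ipos r Ir)).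
  assert (r_gt0 := Ipos r Ir).
  assert (D0 : is_derive Phi r 0).
    apply (locally_eq_is_derive I Phi (fun _ => C)); auto.
      intros x Ix; assert (Wx := normH_sq_pos f x (Ipos x Ix)).
      unfold Phi; rewrite (H x Ix); field; lra.
    apply @is_derive_const.
  assert (E := is_derive_unique _ _ _ D0).
  rewrite (is_derive_unique _ _ _ (DPhi r Ir)) in E.
  assert (0 < r ^ 3) by now apply pow_lt.
  apply Rmult_integral in E as [E|E]; [exfalso; lra|now apply Rminus_diag_uniq_sym].
Qed.

(** The strict inequality for the numerator is what makes the square root below
    differentiable and forbids a change of sign of f'; it holds on the whole open
    interval even though f' could a priori vanish somewhere. *)
Lemma first_integral_admissible (I : R -> Prop) (f : R -> R) (k C : R) :
  is_open_interval I -> (forall r, I r -> 0 < r) ->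
  (forall r, I r -> 16 * r ^ 4 = (C - k * r ^ 4) * normH_sq f r) ->
  admissible k C I.
Proof.
intros HI Ipos H.
assert (Hden : forall r, I r -> 0 < C - k * r ^ 4).
  intros r Ir; specialize (H r Ir); specialize (Ipos r Ir).
  assert (W := normH_sq_pos f r Ipos).
  assert (0 < r ^ 4) by now apply pow_lt.
  nra.
set (h := fun r => k * r ^ 4 + 4 * r ^ 2 - C).
assert (Hnn : forall r, I r -> 0 <= h r).
  intros r Ir; specialize (H r Ir); specialize (Ipos r Ir); specialize (Hden r Ir).
  assert (E : 4 * r ^ 2 * h r = Derive f r ^ 2 * (C - k * r ^ 4)).
    unfold normH_sq in H; unfold h.
    replace (4 * r ^ 2 * (k * r ^ 4 + 4 * r ^ 2 - C))
      with (16 * r ^ 4 - (C - k * r ^ 4) * (4 * r ^ 2)) by ring.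
    rewrite H; ring.
  assert (0 <= Derive f r ^ 2 * (C - k * r ^ 4)) by (apply Rmult_le_pos; nra).
  assert (0 < r ^ 2) by now apply pow_lt.
  nra.
intros r Ir; split; [now apply Hden|].
destruct (Rle_lt_or_eq_dec 0 (h r) (Hnn r Ir)) as [h0|h0]; [exact h0|exfalso].
assert (r_gt0 := Ipos r Ir).
destruct (open_interval_locally I r HI Ir) as [d Hd].
assert (d_gt0 := cond_pos d).
assert (near : forall x, r - d < x < r + d -> I x).
  intros x Hx; apply Hd; apply Rabs_def1; unfold minus, plus, opp; simpl; lra.
assert (D : is_derive h r (4 * k * r ^ 3 + 8 * r)).
  unfold h; auto_derive; [easy|ring].
assert (E : 4 * k * r ^ 3 + 8 * r = 0).
  rewrite <- (is_derive_unique _ _ _ D).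
  assert (pr : derivable_pt h r) by now apply ex_derive_Reals_0; eexists; exact D.
  rewrite <- (Derive_Reals h r pr).
  apply (deriv_minimum h (r - d) (r + d)); try lra.
  intros x H1 H2; rewrite <- h0; apply Hnn, near; lra.
(* At a critical point k r^2 = -2, and then h(s) - h(r) = k (s^2 - r^2)^2 with
   k < 0, so that h becomes negative at any other s. *)
assert (kr : k * r ^ 2 = -2) by nra.
assert (k_lt0 : k < 0) by nra.
set (s := r + d / 2).
assert (Is : I s) by (apply near; unfold s; lra).
assert (Hs : h s = k * (s ^ 2 - r ^ 2) ^ 2).
  replace (h s) with (h s - h r) by lra; unfold h.
  transitivity (k * (s ^ 2 - r ^ 2) ^ 2 + 2 * (k * r ^ 2 + 2) * (s ^ 2 - r ^ 2)).
    ring.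
  rewrite kr; ring.
assert (0 < s ^ 2 - r ^ 2) by (unfold s; nra).
assert (0 < (s ^ 2 - r ^ 2) ^ 2) by now apply pow_lt.
specialize (Hnn s Is); nra.
Qed.

(** * The equation for the slope *)

Definition slope (k C s : R) : R :=
  2 * s * sqrt ((k * s ^ 4 + 4 * s ^ 2 - C) / (C - k * s ^ 4)).

Lemma slope_pos (k C r : R) : 0 < r ->
  0 < C - k * r ^ 4 /\ 0 < k * r ^ 4 + 4 * r ^ 2 - C -> 0 < slope k C r.
Proof.
intros r_gt0 [H1 H2]; apply Rmult_lt_0_compat; [lra|].
now apply sqrt_lt_R0, Rdiv_lt_0_compat.
Qed.

(** The function [slope] squared solves the first integral for f'^2. *)
Lemma slope_sq (k C r : R) :
  0 < C - k * r ^ 4 /\ 0 < k * r ^ 4 + 4 * r ^ 2 - C ->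
  (C - k * r ^ 4) * (slope k C r ^ 2 + 4 * r ^ 2) = 16 * r ^ 4.
Proof.
intros [H1 H2]; unfold slope; rewrite Rpow_mult_distr, pow2_sqrt.
  field; lra.
now apply Rlt_le, Rdiv_lt_0_compat.
Qed.

Lemma slope_continuous (k C r : R) :
  0 < C - k * r ^ 4 /\ 0 < k * r ^ 4 + 4 * r ^ 2 - C -> continuous (slope k C) r.
Proof.
intros [H1 H2]; apply (ex_derive_continuous (K:=R_AbsRing) (V:=R_NormedModule)); unfold slope; auto_derive.
repeat split; [lra|]; now apply Rdiv_lt_0_compat; simpl in *; lra.
Qed.

(** The first integral and its solutions f' = eps * slope are equivalent: f'^2 and
    slope^2 solve the same linear equation, and f' keeps the sign it has at r0. *)
Lemma constant_curvature_slope (I : R -> Prop) (f : R -> R) (r0 k : R) :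
  is_open_interval I -> (forall r, I r -> 0 < r) -> I r0 -> class_C 2 I f ->
  constant_curvature (revolution I f) (revolution_fun f) k <->
  exists C, admissible k C I /\ exists eps, (eps = 1 \/ eps = -1) /\
    forall r, I r -> Derive f r = eps * slope k C r.
Proof.
intros HI Ipos I0 hf; rewrite (first_integral I f r0 k HI Ipos I0 hf); split.
- intros [C H]; exists C.
  assert (HA := first_integral_admissible I f k C HI Ipos H); split; [exact HA|].
  assert (sq : forall r, I r -> Derive f r ^ 2 = slope k C r ^ 2).
    intros r Ir; specialize (H r Ir); rewrite <- (slope_sq k C r (HA r Ir)) in H.
    apply Rmult_eq_reg_l in H; [unfold normH_sq in H; lra|].
    destruct (HA r Ir); lra.
  assert (pos : forall r, I r -> 0 < slope k C r).
    intros r Ir; apply slope_pos; auto.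
  destruct (nonvanishing_constant_sign I (Derive f) r0) as [eps [Heps Hs]]; auto.
  + intros r Ir; apply (ex_derive_continuous (K:=R_AbsRing) (V:=R_NormedModule)).
    exact (proj1 hf 2%nat r (le_n _) Ir).
  + intros r Ir E; specialize (sq r Ir); specialize (pos r Ir); rewrite E in sq; nra.
  + exists eps; split; [exact Heps|]; intros r Ir.
    specialize (sq r Ir); specialize (pos r Ir); specialize (Hs r Ir).
    destruct Heps; subst eps; nra.
- intros [C [HA [eps [Heps H]]]]; exists C; intros r Ir.
  rewrite <- (slope_sq k C r (HA r Ir)); unfold normH_sq; rewrite (H r Ir).
  destruct Heps; subst eps; ring.
Qed.

(** * Integration *)

Lemma profile_is_derive (I : R -> Prop) (k C r0 C' eps r : R) :
  is_open_interval I -> I r0 -> I r -> admissible k C I ->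
  is_derive (profile k C r0 C' eps) r (eps * slope k C r).
Proof.
intros HI I0 Ir HA; unfold profile.
fold (slope k C).
replace (eps * slope k C r) with (plus 0 (scal eps (slope k C r))) by
  (unfold plus, scal; simpl; unfold mult; simpl; ring).
apply @is_derive_plus; [apply @is_derive_const|].
apply is_derive_scal, is_derive_RInt with r0; [|now apply slope_continuous, HA].
apply filter_imp with I; [|now apply open_interval_locally].
intros x Ix; apply @RInt_correct; apply @ex_RInt_continuous; intros z Hz.
now apply slope_continuous, HA, open_interval_minmax with r0 x.
Qed.

Lemma eq_profile_iff_derive (I : R -> Prop) (f : R -> R) (k C r0 eps : R) :
  is_open_interval I -> I r0 -> admissible k C I ->
  (forall r, I r -> ex_derive f r) ->
  (exists C', forall r, I r -> f r = profile k C r0 C' eps r) <->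
  (forall r, I r -> Derive f r = eps * slope k C r).
Proof.
intros HI I0 HA Df; split.
- intros [C' H] r Ir; apply is_derive_unique.
  apply (locally_eq_is_derive I f (profile k C r0 C' eps)); auto.
  now apply profile_is_derive with I.
- intros H; exists (f r0); intros r Ir.
  assert (E : f r - profile k C r0 (f r0) eps r = f r0 - profile k C r0 (f r0) eps r0).
    apply (eq_derive_diff_const I _ _ (fun x => eps * slope k C x)); auto.
      now intros x Ix; rewrite <- (H x Ix); apply Derive_correct, Df.
    now intros x Ix; apply profile_is_derive with I.
  unfold profile at 2 in E; rewrite RInt_point in E; unfold zero in E; simpl in E; lra.
Qed.

(** * Zero curvature *)

(** Differentiating the cubic equation gives a formula for (f - C') f'; squaring
    it and eliminating (f - C')^2 by the equation itself, which is possible as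
    C r^2 > 4 keeps it away from 0, avoids any choice of branch. *)
Lemma flat_cubic_derive_sq (I : R -> Prop) (f : R -> R) (C C' r : R) :
  is_open_interval I -> I r -> C <> 0 -> 0 < C * r ^ 2 - 4 -> ex_derive f r ->
  (forall x, I x -> (f x - C') ^ 2 = 1 / (9 * C ^ 2) * (C * x ^ 2 - 4) ^ 3) ->
  Derive f r ^ 2 = r ^ 2 * (C * r ^ 2 - 4).
Proof.
intros HI Ir C0 q_gt0 Df H.
set (q := C * r ^ 2 - 4) in *.
assert (E : 2 * (f r - C') * Derive f r = 2 * r / (3 * C) * q ^ 2).
  assert (D1 : is_derive (fun x => (f x - C') ^ 2) r (2 * (f r - C') * Derive f r)).
    auto_derive; [easy|]; change (Derive (fun x => f x) r) with (Derive f r); ring.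
  rewrite <- (is_derive_unique _ _ _ D1); apply is_derive_unique.
  apply (locally_eq_is_derive I _ (fun x => 1 / (9 * C ^ 2) * (C * x ^ 2 - 4) ^ 3)); auto.
  auto_derive; [easy|]; unfold q; field; lra.
assert (E2 : 4 * (f r - C') ^ 2 * Derive f r ^ 2 = 4 * r ^ 2 / (9 * C ^ 2) * q ^ 4).
  transitivity ((2 * (f r - C') * Derive f r) ^ 2); [ring|].
  rewrite E; field; lra.
rewrite (H r Ir) in E2; fold q in E2.
apply Rmult_eq_reg_l with (4 * (1 / (9 * C ^ 2) * q ^ 3)).
  rewrite E2; field; lra.
assert (0 < C ^ 2) by (apply pow2_gt_0; lra).
apply Rgt_not_eq, Rmult_lt_0_compat; [lra|]; apply Rmult_lt_0_compat; [|now apply pow_lt].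
apply Rdiv_lt_0_compat; lra.
Qed.

Lemma flat_primitive (C r : R) : C <> 0 -> 0 < C * r ^ 2 - 4 ->
  is_derive (fun x => 1 / (3 * C) * ((C * x ^ 2 - 4) * sqrt (C * x ^ 2 - 4))) r
    (r * sqrt (C * r ^ 2 - 4)).
Proof.
intros C0 q_gt0; auto_derive; [simpl in *; lra|].
replace (C * (r * (r * 1)) + - (4)) with (C * r ^ 2 - 4) by ring.
set (q := C * r ^ 2 - 4) in *.
assert (0 < sqrt q) by now apply sqrt_lt_R0.
assert (E : sqrt q * sqrt q = q) by (apply sqrt_sqrt; lra).
set (s := sqrt q) in *; rewrite <- E; field; lra.
Qed.

Lemma slope_flat (C r : R) : 0 < C -> 0 < 4 * r ^ 2 - C ->
  slope 0 C r = r * sqrt (16 / C * r ^ 2 - 4).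
Proof.
intros C_gt0 H; unfold slope.
assert (q_gt0 : 0 < 16 / C * r ^ 2 - 4).
  replace (16 / C * r ^ 2 - 4) with (4 * ((4 * r ^ 2 - C) / C)) by (field; lra).
  apply Rmult_lt_0_compat; [lra|]; now apply Rdiv_lt_0_compat.
replace ((0 * r ^ 4 + 4 * r ^ 2 - C) / (C - 0 * r ^ 4))
  with ((16 / C * r ^ 2 - 4) / 2 ^ 2) by (field; lra).
set (q := 16 / C * r ^ 2 - 4) in *.
rewrite sqrt_div by lra; rewrite sqrt_pow2 by lra; field.
Qed.

(** The constant C of the cubic is 16 / D, where D is the value of the first
    integral 16 r^4 / W. *)
Lemma flat_iff_cubic (I : R -> Prop) (f : R -> R) (r0 : R) :
  is_open_interval I -> (forall r, I r -> 0 < r) -> class_C 2 I f -> I r0 ->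
  constant_curvature (revolution I f) (revolution_fun f) 0 <->
  exists C C' : R, C <> 0 /\
     (forall r, I r -> 0 < C * r ^ 2 - 4) /\
     (forall r, I r -> (f r - C') ^ 2 = 1 / (9 * C ^ 2) * (C * r ^ 2 - 4) ^ 3).
Proof.
intros HI Ipos hf I0.
assert (Df : forall r, I r -> ex_derive f r).
  intros r Ir; apply (proj1 hf 1%nat r); auto.
split.
- rewrite (constant_curvature_slope I f r0 0 HI Ipos I0 hf).
  intros [D [HA [eps [Heps H]]]].
  assert (D_gt0 : 0 < D) by (destruct (HA r0 I0); lra).
  assert (num : forall r, I r -> 0 < 4 * r ^ 2 - D).
    intros r Ir; destruct (HA r Ir); lra.
  set (C := 16 / D).
  assert (C_gt0 : 0 < C) by (apply Rdiv_lt_0_compat; lra).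
  assert (q_gt0 : forall r, I r -> 0 < C * r ^ 2 - 4).
    intros r Ir; unfold C.
    replace (16 / D * r ^ 2 - 4) with (4 * ((4 * r ^ 2 - D) / D)) by (field; lra).
    apply Rmult_lt_0_compat; [lra|]; apply Rdiv_lt_0_compat; auto.
  set (F := fun x => 1 / (3 * C) * ((C * x ^ 2 - 4) * sqrt (C * x ^ 2 - 4))).
  exists C, (f r0 - eps * F r0); split; [lra|]; split; [exact q_gt0|].
  intros r Ir.
  assert (E : f r - eps * F r = f r0 - eps * F r0).
    apply (eq_derive_diff_const I f (fun x => eps * F x)
      (fun x => eps * (x * sqrt (C * x ^ 2 - 4)))); auto.
      intros x Ix; unfold C; rewrite <- slope_flat by auto.
      rewrite <- (H x Ix); apply Derive_correct; auto.
    intros x Ix; apply is_derive_scal, flat_primitive; auto; lra.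
  replace (f r - (f r0 - eps * F r0)) with (eps * F r) by lra.
  assert (s := sqrt_sqrt (C * r ^ 2 - 4) (Rlt_le _ _ (q_gt0 r Ir))).
  unfold F; set (q := C * r ^ 2 - 4) in *.
  transitivity (eps ^ 2 * (1 / (9 * C ^ 2)) * q ^ 2 * (sqrt q * sqrt q)).
    field; lra.
  rewrite s; destruct Heps; subst eps; field; lra.
- intros [C [C' [C0 [q_gt0 H]]]].
  apply (first_integral I f r0 0 HI Ipos I0 hf); exists (16 / C); intros r Ir.
  unfold normH_sq; rewrite (flat_cubic_derive_sq I f C C' r); auto.
  field; lra.
Qed.

(** * Curvature -1 with vanishing constant *)

Lemma slope_negative_zero (r : R) : 0 < r < 2 -> slope (-1) 0 r = 2 * sqrt (4 - r ^ 2).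
Proof.
intros [r_gt0 r_lt2]; unfold slope.
replace ((-1 * r ^ 4 + 4 * r ^ 2 - 0) / (0 - -1 * r ^ 4))
  with ((4 - r ^ 2) / r ^ 2) by (field; lra).
rewrite sqrt_div by nra; rewrite sqrt_pow2 by lra; field; lra.
Qed.

(** The second term is 4 arcsin (r/2). *)
Lemma arctan_primitive (r : R) : 0 < r < 2 ->
  is_derive (fun x => x * sqrt (4 - x ^ 2) + 4 * atan (x / sqrt (4 - x ^ 2))) r
    (2 * sqrt (4 - r ^ 2)).
Proof.
intros [r_gt0 r_lt2].
assert (q_gt0 : 0 < 4 - r ^ 2) by nra.
assert (s_gt0 : 0 < sqrt (4 - r ^ 2)) by now apply sqrt_lt_R0.
assert (E : sqrt (4 - r ^ 2) ^ 2 = 4 - r ^ 2) by (apply pow2_sqrt; lra).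
auto_derive.
- replace (4 + - (r * (r * 1))) with (4 - r ^ 2) by ring; repeat split; lra.
- replace (4 + - (r * (r * 1))) with (4 - r ^ 2) by ring.
  set (s := sqrt (4 - r ^ 2)) in *.
  assert (Er : r ^ 2 = 4 - s ^ 2) by lra.
  field_simplify_eq; [|split; nra].
  replace (r ^ 4) with ((r ^ 2) ^ 2) by ring.
  rewrite Er; ring.
Qed.

Lemma admissible_zero (I : R -> Prop) : (forall r, I r -> 0 < r) ->
  admissible (-1) 0 I <-> forall r, I r -> r < 2.
Proof.
intros Ipos; split.
- intros HA r Ir; destruct (HA r Ir) as [_ H]; specialize (Ipos r Ir).
  assert (0 < 4 - r ^ 2); [|nra].
  apply Rmult_lt_reg_l with (r ^ 2); [now apply pow_lt|lra].
- intros H r Ir; specialize (H r Ir); specialize (Ipos r Ir).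
  assert (0 < r ^ 4) by now apply pow_lt.
  assert (0 < r ^ 2) by now apply pow_lt.
  assert (0 < r ^ 2 * (4 - r ^ 2)) by (apply Rmult_lt_0_compat; nra).
  split; lra.
Qed.

Lemma profile_zero_closed_form (I : R -> Prop) (f : R -> R) (r0 eps : R) :
  is_open_interval I -> (forall r, I r -> 0 < r) -> I r0 ->
  (forall r, I r -> ex_derive f r) -> (forall r, I r -> r < 2) ->
  (exists C' : R, forall r, I r -> f r = profile (-1) 0 r0 C' eps r) <->
  (exists C' : R, forall r, I r ->
     f r - C' = eps * (r * sqrt (4 - r ^ 2) + 4 * atan (r / sqrt (4 - r ^ 2)))).
Proof.
intros HI Ipos I0 Df lt2.
rewrite eq_profile_iff_derive; auto; [|now apply admissible_zero].
set (G := fun x => x * sqrt (4 - x ^ 2) + 4 * atan (x / sqrt (4 - x ^ 2))).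
assert (DG : forall r, I r -> is_derive (fun x => eps * G x) r (eps * slope (-1) 0 r)).
  intros r Ir; rewrite slope_negative_zero by auto.
  apply is_derive_scal, arctan_primitive; auto.
split.
- intros H; exists (f r0 - eps * G r0); intros r Ir; fold (G r).
  assert (E : f r - eps * G r = f r0 - eps * G r0); [|lra].
  apply (eq_derive_diff_const I f (fun x => eps * G x)
    (fun x => eps * slope (-1) 0 x)); auto.
  intros x Ix; rewrite <- (H x Ix); apply Derive_correct; auto.
- intros [C' H] r Ir; apply is_derive_unique.
  apply (locally_eq_is_derive I f (fun x => C' + eps * G x)); auto.
    intros x Ix; specialize (H x Ix); fold (G x) in H; lra.
  replace (eps * slope (-1) 0 r) with (plus 0 (eps * slope (-1) 0 r)) by
    (unfold plus; simpl; ring).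
  apply @is_derive_plus; [apply @is_derive_const|]; auto.
Qed.

Theorem theorem4p9 (I : R -> Prop) (f : R -> R) (r0 : R)
  (hI : is_open_interval I) (hIpos : forall r, I r -> 0 < r)
  (hf : class_C 2 I f) (hr0 : I r0) :
  (constant_curvature (revolution I f) (revolution_fun f) 0 <->
   exists C C' : R, C <> 0 /\
     (forall r, I r -> 0 < C * r ^ 2 - 4) /\
     (forall r, I r -> (f r - C') ^ 2 = 1 / (9 * C ^ 2) * (C * r ^ 2 - 4) ^ 3)) /\
  (forall k : R, k = 1 \/ k = -1 ->
   (constant_curvature (revolution I f) (revolution_fun f) k <->
    exists C C' : R, admissible k C I /\
      exists eps : R, (eps = 1 \/ eps = -1) /\
        forall r, I r -> f r = profile k C r0 C' eps r)) /\
  (forall k : R, k = 1 \/ k = -1 -> admissible k 0 I -> k = -1) /\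
  (forall eps : R, eps = 1 \/ eps = -1 ->
   ((admissible (-1) 0 I /\
     exists C' : R, forall r, I r -> f r = profile (-1) 0 r0 C' eps r) <->
    ((forall r, I r -> r < 2) /\
     exists C' : R, forall r, I r ->
       f r - C' = eps * (r * sqrt (4 - r ^ 2) + 4 * atan (r / sqrt (4 - r ^ 2)))))).
Proof.
assert (Df : forall r, I r -> ex_derive f r).
  intros r Ir; apply (proj1 hf 1%nat r); auto.
split; [|split; [|split]].
- now apply flat_iff_cubic with r0.
- intros k _; rewrite (constant_curvature_slope I f r0 k hI hIpos hr0 hf); split.
  + intros [C [HA [eps [Heps H]]]].
    apply (eq_profile_iff_derive I f k C r0 eps hI hr0 HA Df) in H as [C' H].
    now exists C, C'; split; [|exists eps].
  + intros [C [C' [HA [eps [Heps H]]]]].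
    exists C; split; [exact HA|]; exists eps; split; [exact Heps|].
    now apply (eq_profile_iff_derive I f k C r0 eps hI hr0 HA Df); exists C'.
- intros k [-> | ->] HA; [|easy].
  destruct (HA r0 hr0) as [H _]; assert (0 < r0 ^ 4) by (apply pow_lt; auto); lra.
- intros eps _; rewrite (admissible_zero I hIpos); split; intros [lt2 H];
    (split; [exact lt2|]); now apply (profile_zero_closed_form I f r0 eps).
Qed.
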